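(* Let $\mathfrak{A}$ be a unital $C^*$-algebra, $a\in\mathfrak{A}$ a nonzero positive element, $t,s\ge 0$ real numbers with $t+s>0$, and let $x\in\mathfrak{A}_a$. Then $$v_{(a,(t,s))}(x)\le\sqrt{(t^2+s^2)\|x\|_a^2+2ts\,v_a(x^2)}\le (t+s)\|x\|_a.$$
   Context: $\mathcal{S}(\mathfrak{A})$ is the set of states of $\mathfrak{A}$ and $\mathcal{S}_a(\mathfrak{A})=\{f/f(a): f\in\mathcal{S}(\mathfrak{A}),\ f(a)\ne 0\}$. For $x\in\mathfrak{A}$, $\|x\|_a=\sup\{\sqrt{f(x^*ax)}: f\in\mathcal{S}_a(\mathfrak{A})\}\in[0,\infty]$, and the $a$-numerical radius is $v_a(x)=\sup\{|f(ax)|: f\in\mathcal{S}_a(\mathfrak{A})\}$. An element $x^{\sharp_a}\in\mathfrak{A}$ is an $a$-adjoint of $x$ if $ax^{\sharp_a}=x^*a$; $\mathfrak{A}_a$ is the set of all elements of $\mathfrak{A}$ admitting an $a$-adjoint (a subalgebra of $\mathfrak{A}$ on which $\|\cdot\|_a$ is a finite semi-norm). $a$-adjoints need not be unique; $x^{\sharp_a}$ denotes an $a$-adjoint of $x$, with $(\lambda x)^{\sharp_a}=\overline{\lambda}x^{\sharp_a}$ for $\lambda\in\mathbb{C}$; the quantities in the claim do not depend on the choice. For $x\in\mathfrak{A}_a$ put $\mathfrak{R}_{(t,s)}(x)=tx+sx^{\sharp_a}$ and $v_{(a,(t,s))}(x)=\sup_{\theta\in\mathbb{R}}\|\mathfrak{R}_{(t,s)}(e^{i\theta}x)\|_a$.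 *)

(* Defs.v *)
From HB Require Import structures.
From mathcomp Require Import all_boot all_order all_algebra.
From mathcomp Require Import complex.
From mathcomp Require Import all_classical all_reals all_analysis.

Set Implicit Arguments.
Unset Strict Implicit.
Unset Printing Implicit Defensive.

Import Order.TTheory GRing.Theory Num.Theory.
Import numFieldNormedType.Exports.

Local Open Scope classical_set_scope.
Local Open Scope complex_scope.
Local Open Scope ring_scope.

(* The norm is part of the mixin because Num.NumDomain, whose norm is
   self-valued, is already the Hierarchy-Builder join of the semiring and
   semi-normed structures, so that algType and normedModType cannot be
   joined. *)
HB.mixin Record isCStarAlgebra (R : realType) (A : Type)
    & GRing.Algebra R[i] A := {
  star : A -> A ;
  starK : involutive star ;
  starD : forall x y : A, star (x + y) = star x + star y ;
  starZ : forall (k : R[i]) (x : A), star (k *: x) = k^* *: star x ;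
  starM : forall x y : A, star (x * y) = star y * star x ;
  cnorm : A -> R ;
  cnorm_eq0 : forall x : A, cnorm x = 0 -> x = 0 ;
  cnormD : forall x y : A, cnorm (x + y) <= cnorm x + cnorm y ;
  cnormZ : forall (k : R[i]) (x : A),
    cnorm (k *: x) = ComplexField.Normc.normc k * cnorm x ;
  cnormM : forall x y : A, cnorm (x * y) <= cnorm x * cnorm y ;
  cnorm_star : forall x : A, cnorm (star x * x) = cnorm x ^+ 2 ;
  cnorm_complete : forall u : nat -> A,
    (forall e : R, 0 < e -> exists N : nat, forall m n : nat,
       (N <= m)%N -> (N <= n)%N -> cnorm (u m - u n) < e) ->
    exists l : A, (fun n => cnorm (u n - l)) @ \oo --> (0 : R)
}.

#[short(type="cstarAlgType")]
HB.structure Definition CStarAlgebra (R : realType) :=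
  {A of GRing.Algebra R[i] A & isCStarAlgebra R A}.

Section SemiHilbert.
Variables (R : realType) (A : cstarAlgType R).

Definition positive (a : A) : Prop := exists b : A, a = star b * b.

Definition bounded_functional (f : A -> R[i]) : Prop :=
  exists M : R, forall x, ComplexField.Normc.normc (f x) <= M * cnorm x.

Definition states : set (A -> R[i]) :=
  [set f | [/\ scalar f, bounded_functional f,
              forall p : A, positive p -> 0 <= f p
            & f 1 = 1]].

Definition states_at (a : A) : set (A -> R[i]) :=
  [set g | exists2 f, states f & f a != 0 /\ g = (fun x => f x / f a)].

(* The supremum in the ordered set [0, +oo]; adjoining the least element 0 is
   immaterial unless S is empty. *)
Definition nneg_sup (S : set (\bar R)) : \bar R := ereal_sup (0%E |` S).

(* For f in [states_at a], f (star x * a * x) is a nonnegative real, so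
   taking its real part only changes its type. *)
Definition anorm (a x : A) : \bar R :=
  nneg_sup [set (Num.sqrt (complex.Re (f (star x * a * x))))%:E
           | f in states_at a].

Definition anumrad (a x : A) : \bar R :=
  nneg_sup [set (ComplexField.Normc.normc (f (a * x)))%:E | f in states_at a].

Definition is_aadjoint (a x y : A) : Prop := a * y = star x * a.

Definition has_aadjoint (a : A) : set A := [set x | exists y, is_aadjoint a x y].

Definition aadjoint_choice (a : A) (sharp : A -> A) : Prop :=
  (forall x, has_aadjoint a x -> is_aadjoint a x (sharp x)) /\
  (forall (k : R[i]) x, has_aadjoint a x -> sharp (k *: x) = k^* *: sharp x).

Definition areal_part (sharp : A -> A) (t s : R) (x : A) : A :=
  t%:C *: x + s%:C *: sharp x.

Definition cis (theta : R) : R[i] := cos theta +i* sin theta.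

Definition anumrad_ts (a : A) (sharp : A -> A) (t s : R) (x : A) : \bar R :=
  nneg_sup (range (fun theta : R =>
    anorm a (areal_part sharp t s (cis theta *: x)))).

End SemiHilbert.

(* Main.v *)
(* For g in S_a the form (u, v) |-> g(v^* a u) is a positive semi-definite
   Hermitian form with g(a) = 1. If w is an a-adjoint of z, then compressing g
   to u |-> g(w^* u w) / g(w^* a w), again an element of S_a, and applying
   Cauchy-Schwarz to g(w^* a w) = g(a z w) shows ||w||_a <= ||z||_a. Expanding
   ||t z + s w||_a^2 for z = e^(i theta) x, the diagonal terms are at most
   (t^2 + s^2) ||x||_a^2, and the cross terms sum to 2 t s Re g(a z^2), which is
   at most 2 t s v_a(x^2); finally a x = y^* a, for y an a-adjoint of x, gives
   v_a(x^2) <= ||x||_a ||y||_a <= ||x||_a^2. *)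
Require Import Defs.
From HB Require Import structures.
From mathcomp Require Import all_boot all_order all_algebra.
From mathcomp Require Import complex.
From mathcomp Require Import all_classical all_reals all_analysis.
From mathcomp Require Import ring lra.
Set Implicit Arguments.
Unset Strict Implicit.
Unset Printing Implicit Defensive.

Import Order.TTheory GRing.Theory Num.Theory.
Local Open Scope ring_scope.

(** * Complex modulus and a discriminant inequality *)

Lemma normc_sqr (R : realType) (z : R[i]) :
  ComplexField.Normc.normc z ^+ 2 = complex.Re z ^+ 2 + complex.Im z ^+ 2.
Proof. by case: z => x y; rewrite sqr_sqrtr ?addr_ge0 ?sqr_ge0. Qed.

Lemma Re_le_normc (R : realType) (z : R[i]) :
  complex.Re z <= ComplexField.Normc.normc z.
Proof.
case: z => x y; apply: le_trans (ler_norm x) _; rewrite -sqrtr_sqr.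
by rewrite ler_sqrt ?addr_ge0 ?sqr_ge0// lerDl sqr_ge0.
Qed.

Lemma normc_ge0 (R : realType) (z : R[i]) : 0 <= ComplexField.Normc.normc z.
Proof. by case: z => x y; apply: sqrtr_ge0. Qed.

Lemma normc_cis (R : realType) (theta : R) :
  ComplexField.Normc.normc (cis theta) = 1.
Proof. by rewrite /= cos2Dsin2 sqrtr1. Qed.

Lemma Re_divr_real (R : realType) (z y : R[i]) : complex.Im y = 0 ->
  complex.Re (z / y) = complex.Re z / complex.Re y.
Proof.
case: z y => z z' [y y'] /= ->.
have [->|y_neq0] := eqVneq y 0.
  by rewrite !(mul0r, oppr0, mulr0, invr0, subr0).
by field.
Qed.

(** The discriminant step of Cauchy-Schwarz, with [k] the squared modulus of the off-diagonal value
    and [p], [q] the diagonal values. For [p != 0] the quadratic in [m] is minimal at [p^-1]. *)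
Lemma ler_of_discr (R : realType) (p q k : R) : 0 <= p -> 0 <= k ->
  (forall m, 0 <= m ^+ 2 * k * p - 2 * m * k + q) -> k <= p * q.
Proof.
move=> p0 k0 H; have [->|k_neq0] := eqVneq k 0.
  have := H 0; rewrite expr0n !mul0r mulr0 !mul0r subr0 add0r.
  exact: mulr_ge0.
have {k0 k_neq0}k_gt0 : 0 < k by rewrite lt_def k_neq0.
have [p_eq0|p_neq0] := eqVneq p 0.
  (* For [p = 0] the expression is affine in [m]; this [m] gives it the value -1. *)
  have := H ((q + 1) / (2 * k)); rewrite p_eq0 mulr0 add0r.
  have -> : 2 * ((q + 1) / (2 * k)) * k = q + 1 by field; lra.
  lra.
have := mulr_ge0 p0 (H p^-1).
have -> : p * (p^-1 ^+ 2 * k * p - 2 * p^-1 * k + q) = p * q - k by field.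
by rewrite subr_ge0.
Qed.

(** * Involution and positive elements *)

Lemma star1 (R : realType) (A : cstarAlgType R) : star 1 = 1 :> A.
Proof. by rewrite -[RHS]starK -[star 1 in RHS]mulr1 starM starK mulr1. Qed.

Lemma positive1 (R : realType) (A : cstarAlgType R) : positive (1 : A).
Proof. by exists 1; rewrite star1 mulr1. Qed.

Lemma positive_star_mul (R : realType) (A : cstarAlgType R) (u : A) :
  positive (star u * u).
Proof. by exists u. Qed.

Lemma star_positive (R : realType) (A : cstarAlgType R) (p : A) :
  positive p -> star p = p.
Proof. by move=> [b ->]; rewrite starM starK. Qed.

Lemma positive_conj (R : realType) (A : cstarAlgType R) (p w : A) :
  positive p -> positive (star w * p * w).
Proof. by move=> [b ->]; exists (b * w); rewrite starM !mulrA. Qed.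

(** * Positive functionals and Cauchy-Schwarz *)

Section PositiveFunctional.
Variables (R : realType) (A : cstarAlgType R) (f : A -> R[i]).
Implicit Types (p u v w : A) (k : R[i]).
Hypothesis f_scalar : scalar f.
Hypothesis f_ge0 : forall p, positive p -> 0 <= f p.

Lemma functionalD u v : f (u + v) = f u + f v.
Proof. by rewrite -[u in LHS]scale1r f_scalar mul1r. Qed.

Lemma functional0 : f 0 = 0.
Proof. by apply: (addrI (f 0)); rewrite -functionalD !addr0. Qed.

Lemma functionalZ k u : f (k *: u) = k * f u.
Proof. by rewrite -[k *: u in LHS]addr0 f_scalar functional0 addr0. Qed.

Lemma functional_form p k l u v :
  f (star (k *: u + l *: v) * p * (k *: u + l *: v)) =
  k^*%C * k * f (star u * p * u) + k^*%C * l * f (star u * p * v)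
    + l^*%C * k * f (star v * p * u) + l^*%C * l * f (star v * p * v).
Proof.
rewrite starD !starZ !mulrDl !mulrDr -!(@scalerAl _ A) -!(@scalerAr _ A).
rewrite !scalerA.
by rewrite !functionalD !functionalZ !addrA.
Qed.

Lemma functional_real p : positive p -> complex.Im (f p) = 0.
Proof. by move=> /f_ge0/ger0_Im. Qed.

Lemma functional_Re_ge0 p : positive p -> 0 <= complex.Re (f p).
Proof. by move=> /f_ge0; rewrite complex.lecE => /andP[]. Qed.

Lemma functional_Re_eq0 p : positive p -> complex.Re (f p) = 0 -> f p = 0.
Proof. by move=> /functional_real; case: (f p) => x y /= -> ->. Qed.

(** Polarization: [f] is real at [star (k *: u + 1) * (k *: u + 1)]. Taking [k = 1] relates the
    imaginary parts of [f u] and [f (star u)], and [k = i] their real parts. *)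
Lemma functional_star u : f (star u) = (f u)^*%C.
Proof.
have H k : complex.Im (f (star (k *: u + 1 *: 1) * 1 * (k *: u + 1 *: 1))) = 0.
  exact/functional_real/positive_conj/positive1.
have := H (Complex 0 1); have := H 1.
rewrite !functional_form star1 !(mul1r, mulr1).
have := functional_real (positive_star_mul u).
have := functional_real (positive1 A).
case: (f u) (f (star u)) (f (star u * u)) (f 1).
move=> a b [c d] [e e'] [g g'] /= -> -> h1 h2.
by congr Complex; lra.
Qed.

Lemma functional_cauchy_schwarz p u v : positive p ->
  ComplexField.Normc.normc (f (star v * p * u)) ^+ 2
  <= complex.Re (f (star u * p * u)) * complex.Re (f (star v * p * v)).
Proof.
move=> p_pos; apply: ler_of_discr => [||m].
- exact/functional_Re_ge0/positive_conj.
- exact: sqr_ge0.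
(* With [c = f (star v * p * u)], the coefficient [- m c^*] turns both cross terms into [- m |c|^2],
   which yields the quadratic of [ler_of_discr]. *)
have := functional_Re_ge0 (positive_conj
  ((- (Complex m 0 * (f (star v * p * u))^*%C)) *: u + 1 *: v) p_pos).
rewrite functional_form normc_sqr.
have -> : f (star u * p * v) = (f (star v * p * u))^*%C.
  by rewrite -functional_star !starM starK (star_positive p_pos) mulrA.
have := functional_real (positive_conj u p_pos).
case: (f (star v * p * u)) (f (star u * p * u)) (f (star v * p * v)).
move=> a b [c d] [e e'] /= -> H; apply: le_trans H _.
by rewrite le_eqVlt; apply/orP; left; apply/eqP; ring.
Qed.

End PositiveFunctional.

(** The triangle inequality for [x - x] gives [0 <= 2 * cnorm x]. *)
Lemma cnorm_ge0 (R : realType) (A : cstarAlgType R) (x : A) : 0 <= cnorm x.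
Proof.
have c0 : cnorm (0 : A) = 0.
  by rewrite -[0 in LHS](scale0r 1) cnormZ ComplexField.Normc.normc0 mul0r.
have cN : cnorm (- x) = cnorm x.
  rewrite -scaleN1r cnormZ complex.normcN.
  by rewrite ComplexField.Normc.normc1 mul1r.
by have := cnormD x (- x); rewrite subrr c0 cN -mulr2n pmulrn_lge0.
Qed.

(** * States normalised at [a], and [a]-adjoints *)

Section StatesAt.
Variables (R : realType) (A : cstarAlgType R) (a : A).
Hypothesis a_pos : positive a.
Implicit Types (g : A -> R[i]) (u v w z : A).

Lemma states_atP g : states_at a g ->
  [/\ scalar g, forall p, positive p -> 0 <= g p & g a = 1].
Proof.
move=> [f [f_scalar _ f_ge0 f1] [fa_neq0 ->]]; split => [k u v|p p_pos|].
- by rewrite f_scalar mulrDl mulrA.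
- by rewrite divr_ge0 ?f_ge0.
- by rewrite divff.
Qed.

Lemma states_at_conj g w : states_at a g -> g (star w * a * w) != 0 ->
  states_at a (fun u => g (star w * u * w) / g (star w * a * w)).
Proof.
move=> [f [f_scalar [M fM] f_ge0 f1] [fa_neq0 ->]].
rewrite mulf_eq0 invr_eq0 negb_or => /andP[fwaw_neq0 _].
(* A state vanishing at w^* w also vanishes at w^* (a w). *)
have fww_neq0 : f (star w * w) != 0.
  apply: contraNneq fwaw_neq0 => fww0.
  have := functional_cauchy_schwarz f_scalar f_ge0 (a * w) w (positive1 A).
  rewrite !mulr1 fww0 mulr0 mulrA => h.
  have /eqP : ComplexField.Normc.normc (f (star w * a * w)) ^+ 2 = 0.
    by apply/le_anti; rewrite h sqr_ge0.
  by rewrite sqrf_eq0 => /eqP/ComplexField.Normc.eq0_normc ->.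
(* The compressed functional, normalised at 1. Dividing it by its value at [a] cancels
   [f (star w * w)], and [f a] cancels in the target. *)
exists (fun u => f (star w * u * w) / f (star w * w)); last first.
  split; first by rewrite mulf_neq0 ?invr_eq0.
  apply/funext => u; field.
  by rewrite fww_neq0 fa_neq0 fwaw_neq0.
split.
- move=> k u v; rewrite mulrDr mulrDl -(@scalerAr _ A) -(@scalerAl _ A) f_scalar.
  by rewrite mulrDl mulrA.
(* The bound [M] may be negative, hence the absolute value; the rest is submultiplicativity of the
   norm. *)
- exists (`|M| * cnorm (star w) * cnorm w
      / ComplexField.Normc.normc (f (star w * w))) => u.
  rewrite ComplexField.Normc.normcM ComplexField.Normc.normcV.
  rewrite mulrAC; apply: ler_wpM2r; first by rewrite invr_ge0 normc_ge0.
  apply: le_trans (fM _) _.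
  apply: (@le_trans _ _ (`|M| * cnorm (star w * u * w))).
    by apply: ler_wpM2r; rewrite ?cnorm_ge0 ?ler_norm.
  rewrite -!mulrA; apply: ler_wpM2l => //.
  apply: le_trans (cnormM _ _) _; rewrite mulrA mulrAC.
  by rewrite -mulrA; apply: ler_wpM2l; rewrite ?cnorm_ge0 ?cnormM.
- move=> p p_pos; apply: divr_ge0; apply: f_ge0; first exact: positive_conj.
  exact: positive_star_mul.
- by rewrite mulr1 divff.
Qed.

Lemma aadjoint_sym z w : is_aadjoint a z w -> a * z = star w * a.
Proof.
by move=> /(congr1 (@star R A)); rewrite !starM starK (star_positive a_pos).
Qed.

Lemma aadjoint_form_le (K : R) z w : is_aadjoint a z w ->
  (forall g, states_at a g -> complex.Re (g (star z * a * z)) <= K) ->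
  forall g, states_at a g -> complex.Re (g (star w * a * w)) <= K.
Proof.
move=> zw zK g ga; have [g_scalar g_ge0 ga1] := states_atP ga.
have zz_ge0 := functional_Re_ge0 g_ge0 (positive_conj z a_pos).
have ww_ge0 := functional_Re_ge0 g_ge0 (positive_conj w a_pos).
have [ww0|ww_neq0] := eqVneq (g (star w * a * w)) 0.
  by rewrite ww0 (le_trans zz_ge0)// zK.
have := zK _ (states_at_conj ga ww_neq0).
(* Since [a * z * w = star w * a * w], with [r = g (star w * a * w)] this reads
   [r^2 <= g (star w * (star z * a * z) * w)]. The compressed state bounds the right side by
   [K * r], and [r > 0] cancels. *)
have := functional_cauchy_schwarz g_scalar g_ge0 (z * w) 1 a_pos.
rewrite star1 !mul1r mulr1 ga1 /= mulr1 mulrA (aadjoint_sym zw) normc_sqr.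
have ww_real := functional_real g_ge0 (positive_conj w a_pos).
have -> : star (z * w) * a * (z * w) = star w * (star z * a * z) * w.
  by rewrite starM !mulrA.
have : 0 < complex.Re (g (star w * a * w)).
  rewrite lt_def ww_ge0 andbT; apply: contraNneq ww_neq0 => h.
  exact/eqP/functional_Re_eq0/h/positive_conj.
rewrite ww_real expr0n addr0 Re_divr_real// => ww_gt0 ww_le.
rewrite ler_pdivrMr// => zw_le.
by rewrite -(ler_pM2r ww_gt0) -expr2 (le_trans ww_le).
Qed.

(** Rewriting [a * z ^+ 2] as [star w * a * z] makes this Cauchy-Schwarz for the pair [z], [w]. *)
Lemma aadjoint_sqr_le (K : R) g z w : is_aadjoint a z w -> states_at a g ->
  complex.Re (g (star z * a * z)) <= K -> complex.Re (g (star w * a * w)) <= K ->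
  ComplexField.Normc.normc (g (a * z ^+ 2)) <= K.
Proof.
move=> zw ga zK wK; have [g_scalar g_ge0 _] := states_atP ga.
have zz_ge0 := functional_Re_ge0 g_ge0 (positive_conj z a_pos).
have ww_ge0 := functional_Re_ge0 g_ge0 (positive_conj w a_pos).
have K_ge0 := le_trans zz_ge0 zK.
rewrite -(@ler_pXn2r _ 2) ?nnegrE ?normc_ge0// expr2 mulrA (aadjoint_sym zw).
apply: le_trans (functional_cauchy_schwarz g_scalar g_ge0 _ _ a_pos) _.
by rewrite expr2 ler_pM.
Qed.

Lemma aadjoint_combination_le (K V t s : R) g z w : 0 <= t -> 0 <= s ->
  is_aadjoint a z w -> states_at a g ->
  complex.Re (g (star z * a * z)) <= K -> complex.Re (g (star w * a * w)) <= K ->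
  ComplexField.Normc.normc (g (a * z ^+ 2)) <= V ->
  complex.Re (g (star (t%:C%C *: z + s%:C%C *: w) * a
                 * (t%:C%C *: z + s%:C%C *: w)))
  <= (t ^+ 2 + s ^+ 2) * K + 2 * t * s * V.
Proof.
move=> t_ge0 s_ge0 zw ga zK wK zzV; have [g_scalar g_ge0 _] := states_atP ga.
have azz : star w * a * z = a * z ^+ 2 by rewrite expr2 mulrA (aadjoint_sym zw).
have zaw : g (star z * a * w) = (g (a * z ^+ 2))^*%C.
  rewrite -(functional_star g_scalar g_ge0) -azz !starM starK.
  by rewrite (star_positive a_pos) mulrA.
rewrite functional_form// azz zaw.
(* The cross terms are conjugate, so only the real part of [g (a * z ^+ 2)] enters. *)
have {zzV} := le_trans (Re_le_normc _) zzV.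
case: (g (a * _)) (g (star z * a * z)) (g (star w * a * w)) zK wK {zaw}.
move=> b b' [c c'] [d d'] /= cK dK bV.
have tK := ler_wpM2l (sqr_ge0 t) cK.
have sK := ler_wpM2l (sqr_ge0 s) dK.
have tsV := ler_wpM2l (mulr_ge0 t_ge0 s_ge0) bV.
nra.
Qed.

(** * From extended suprema to bounds on quadratic forms *)

Lemma nneg_sup_ge0 (S : set (\bar R)) : (0 <= nneg_sup S)%E.
Proof. by apply: ereal_sup_ubound; left. Qed.

Lemma nneg_sup_ubound (S : set (\bar R)) e : S e -> (e <= nneg_sup S)%E.
Proof. by move=> Se; apply: ereal_sup_ubound; right. Qed.

Lemma nneg_sup_le (S : set (\bar R)) e : (0 <= e)%E ->
  (forall e', S e' -> (e' <= e)%E) -> (nneg_sup S <= e)%E.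
Proof. by move=> e_ge0 Se; apply: ge_ereal_sup => e' [->//|/Se]. Qed.

Lemma anorm_le (N : R) u : 0 <= N -> (anorm a u <= N%:E)%E <->
  forall g, states_at a g -> complex.Re (g (star u * a * u)) <= N ^+ 2.
Proof.
move=> N_ge0; split => [uN g ga|uN].
  have : ((Num.sqrt (complex.Re (g (star u * a * u))))%:E <= N%:E)%E.
    by apply: le_trans uN; apply: nneg_sup_ubound; exists g.
  have [_ g_ge0 _] := states_atP ga.
  rewrite lee_fin -(@ler_pXn2r _ 2) ?nnegrE ?sqrtr_ge0// sqr_sqrtr//.
  exact/functional_Re_ge0/positive_conj.
apply: nneg_sup_le => [|_ [g ga <-]]; first by rewrite lee_fin.
rewrite lee_fin -(ger0_norm N_ge0) -sqrtr_sqr ler_sqrt ?sqr_ge0//; exact: uN.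
Qed.

End StatesAt.

Theorem theorem2p9 (R : realType) (A : cstarAlgType R) (a : A)
    (a_pos : positive a) (a_neq0 : a != 0)
    (sharp : A -> A) (sharpP : aadjoint_choice a sharp)
    (t s : R) (t_ge0 : 0 <= t) (s_ge0 : 0 <= s) (ts_gt0 : 0 < t + s)
    (x : A) (xA : has_aadjoint a x) :
  (anumrad_ts a sharp t s x
     <= sqrte ((t ^+ 2 + s ^+ 2)%:E * (anorm a x) ^+ 2
               + (2 * t * s)%:E * anumrad a (x ^+ 2)%R))%E
  /\
  (sqrte ((t ^+ 2 + s ^+ 2)%:E * (anorm a x) ^+ 2
          + (2 * t * s)%:E * anumrad a (x ^+ 2)%R)
     <= (t + s)%:E * anorm a x)%E.
Proof.
have ts2_ge0 : 0 <= 2 * t * s by rewrite !mulr_ge0.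
have t2s2_gt0 : 0 < t ^+ 2 + s ^+ 2.
  (* Uses [(t + s)^2 + (t - s)^2 = 2 (t^2 + s^2)]. *)
  have := exprn_gt0 2 ts_gt0; have := sqr_ge0 (t - s); lra.
case xN : (anorm a x) (nneg_sup_ge0 _ : 0 <= anorm a x)%E
  => [N| |] // N_ge0; last first.
  (* If [anorm a x] is infinite, both upper bounds are [+oo]; nonnegativity of the cross term
     excludes [+oo + -oo]. *)
  have xr_ge0 : (0 <= (2 * t * s)%:E * anumrad a (x ^+ 2)%R)%E.
    by rewrite mule_ge0 ?lee_fin ?nneg_sup_ge0.
  rewrite expe2 mulyy gt0_muley ?lte_fin// addye; last first.
    by apply: contraTneq xr_ge0 => ->.
  by rewrite gt0_muley ?lte_fin// leey.
rewrite lee_fin in N_ge0.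
have xN2 : forall g, states_at a g -> complex.Re (g (star x * a * x)) <= N ^+ 2.
  by apply/anorm_le => //; rewrite xN.
(* This makes [anumrad a (x ^+ 2)] finite and later yields the second inequality. *)
have xrN : (anumrad a (x ^+ 2)%R <= (N ^+ 2)%:E)%E.
  case: xA => y xy.
  apply: nneg_sup_le => [|_ [g ga <-]]; rewrite lee_fin ?sqr_ge0//.
  apply: (aadjoint_sqr_le a_pos xy ga (xN2 _ ga)).
  exact: (aadjoint_form_le a_pos xy xN2 ga).
case xV : (anumrad a (x ^+ 2)%R) xrN
  (nneg_sup_ge0 _ : 0 <= anumrad a (x ^+ 2)%R)%E => [V| |] //.
rewrite !lee_fin => VN V_ge0; rewrite expe2 -!EFinM -EFinD /=.
have K_ge0 : 0 <= (t ^+ 2 + s ^+ 2) * (N * N) + 2 * t * s * V.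
  by rewrite addr_ge0 ?mulr_ge0 ?(ltW t2s2_gt0).
split.
  apply: nneg_sup_le => [|_ [theta _ <-]]; first by rewrite lee_fin sqrtr_ge0.
  apply/anorm_le; rewrite ?sqrtr_ge0// => g ga; rewrite sqr_sqrtr//.
  have [y xy] := xA.
  have zw : is_aadjoint a (cis theta *: x) (sharp (cis theta *: x)).
    apply: sharpP.1; exists ((cis theta)^*%C *: y).
    by rewrite /is_aadjoint starZ -(@scalerAl _ A) -(@scalerAr _ A) xy.
  (* The phase has modulus 1, so [cis theta *: x] inherits the bound [N ^+ 2] from [x]. *)
  have cisJ : (cis theta)^*%C * cis theta = 1.
    rewrite /cis; apply: (congr2 (@Complex R)); last by rewrite mulNr mulrC subrr.
    by rewrite mulNr opprK -!expr2 cos2Dsin2.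
  have zN g' : states_at a g' ->
      complex.Re (g' (star (cis theta *: x) * a * (cis theta *: x))) <= N ^+ 2.
    move=> g'a; rewrite starZ -!(@scalerAl _ A) -(@scalerAr _ A) scalerA.
    by rewrite cisJ scale1r; exact: xN2.
  apply: (aadjoint_combination_le a_pos t_ge0 s_ge0 zw ga (zN g ga)) => //.
    exact: (aadjoint_form_le a_pos zw zN ga).
  rewrite exprZn -(@scalerAr _ A).
  have [g_scalar g_ge0 _] := states_atP a_pos ga.
  rewrite (functionalZ g_scalar) ComplexField.Normc.normcM.
  rewrite expr2 ComplexField.Normc.normcM normc_cis !mul1r -lee_fin -xV.
  by apply: nneg_sup_ubound; exists g.
(* Comparing squares, [V <= N ^+ 2] completes [(t^2 + s^2) N^2 + 2 t s V] to at most
   [(t + s)^2 N^2]. *)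
rewrite -[leRHS]ger0_norm ?mulr_ge0 ?(ltW ts_gt0)// -sqrtr_sqr ler_wsqrtr//.
have := ler_wpM2l ts2_ge0 VN; lra.
Qed.
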